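(* Let $3\le\alpha<\omega$. The class of all set algebras of the form $\langle A,+,-,C_i^U,D_{ij}^U,P_{01}\rangle_{i,j<\alpha}$ (for arbitrary base sets $U$) has no equational axiom set in which $p_{01}$ occurs only finitely many times.
   Context: Here $A$ is a set of subsets of $U^\alpha$ containing all $D^U_{ij}$ and closed under the operations, where $+$ is union, $-$ is complement with respect to $U^\alpha$, $C^U_i(X)=\{u\in U^\alpha : \text{there is } u'\in X \text{ with } u_j=u'_j \text{ for all } j\neq i\}$, $D^U_{ij}=\{u\in U^\alpha : u_i=u_j\}$, and $P_{01}(X)=\{u\in U^\alpha : \text{there is } u'\in X \text{ with } u_0=u'_1,\ u_1=u'_0,\ u_l=u'_l \text{ for all } l\notin\{0,1\}\}$. The formal language has operation symbols $+,-,c_i,d_{ij}$ $(i,j<\alpha)$ and $p_{01}$, interpreted as $+,-,C_i^U,D_{ij}^U,P_{01}$. An equational axiom set for a class of algebras is a set of equations true in the class from which all equations true in the class are derivable. ``$p_{01}$ occurs finitely many times'' means that the total number of occurrences of the symbol $p_{01}$ in the members of the axiom set is finite. *)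

(* Defs.v *)
From mathcomp Require Import all_boot.
From mathcomp Require Import boolp classical_sets functions cardinality.

Set Implicit Arguments.
Unset Strict Implicit.
Unset Printing Implicit Defensive.

Local Open Scope classical_set_scope.

Inductive term (α : nat) : Type :=
| Var of nat
| Plus of term α & term α
| Minus of term α
| Cyl of 'I_α & term α
| Diag of 'I_α & 'I_α
| Perm of term α.

Arguments Var {α}.
Arguments Diag {α}.

Fixpoint subst (α : nat) (f : nat -> term α) (t : term α) : term α :=
  match t with
  | Var n => f n
  | Plus t1 t2 => Plus (subst f t1) (subst f t2)
  | Minus t1 => Minus (subst f t1)
  | Cyl i t1 => Cyl i (subst f t1)
  | Diag i j => Diag i j
  | Perm t1 => Perm (subst f t1)
  end.

Fixpoint occ_p01 (α : nat) (t : term α) : nat :=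
  match t with
  | Var _ => 0
  | Plus t1 t2 => occ_p01 t1 + occ_p01 t2
  | Minus t1 => occ_p01 t1
  | Cyl _ t1 => occ_p01 t1
  | Diag _ _ => 0
  | Perm t1 => (occ_p01 t1).+1
  end.

(* The pair (s, t) stands for the equation s = t. *)
Definition equation (α : nat) : Type := (term α * term α)%type.

Definition eq_occ_p01 (α : nat) (e : equation α) : nat :=
  occ_p01 e.1 + occ_p01 e.2.

(* The occurrences of p01 in the members of E are indexed by the pairs (e, k)
   with e in E and k smaller than the number of occurrences in e; an equation
   is a single member, and its occurrences are counted once. *)
Definition p01_occurs_finitely (α : nat) (E : set (equation α)) : Prop :=
  finite_set [set ek : equation α * nat | E ek.1 /\ ek.2 < eq_occ_p01 ek.1].

(* Birkhoff's rules of equational logic. *)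
Inductive derivable (α : nat) (E : set (equation α)) :
    term α -> term α -> Prop :=
| DAx s t : E (s, t) -> derivable E s t
| DRefl t : derivable E t t
| DSym s t : derivable E s t -> derivable E t s
| DTrans s t r : derivable E s t -> derivable E t r -> derivable E s r
| DSubst f s t : derivable E s t -> derivable E (subst f s) (subst f t)
| DPlus s s' t t' : derivable E s s' -> derivable E t t' ->
    derivable E (Plus s t) (Plus s' t')
| DMinus s s' : derivable E s s' -> derivable E (Minus s) (Minus s')
| DCyl i s s' : derivable E s s' -> derivable E (Cyl i s) (Cyl i s')
| DPerm s s' : derivable E s s' -> derivable E (Perm s) (Perm s').

Record algebra (α : nat) : Type := Algebra {
  carrier : Type;
  op_plus : carrier -> carrier -> carrier;
  op_minus : carrier -> carrier;
  op_c : 'I_α -> carrier -> carrier;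
  op_d : 'I_α -> 'I_α -> carrier;
  op_p01 : carrier -> carrier }.

Fixpoint eval (α : nat) (B : algebra α) (v : nat -> carrier B) (t : term α) :
    carrier B :=
  match t with
  | Var n => v n
  | Plus t1 t2 => op_plus (eval v t1) (eval v t2)
  | Minus t1 => op_minus (eval v t1)
  | Cyl i t1 => op_c i (eval v t1)
  | Diag i j => op_d B i j
  | Perm t1 => op_p01 (eval v t1)
  end.

Definition true_in (α : nat) (K : algebra α -> Prop) (e : equation α) : Prop :=
  forall B : algebra α, K B ->
  forall v : nat -> carrier B, eval v e.1 = eval v e.2.

Definition equational_axiom_set (α : nat) (K : algebra α -> Prop)
    (E : set (equation α)) : Prop :=
  (forall e, E e -> true_in K e) /\
  (forall e, true_in K e -> derivable E e.1 e.2).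

(* U^α is the type 'I_α -> U. *)
Definition cylinder (α : nat) (U : Type) (i : 'I_α) (X : set ('I_α -> U)) :
    set ('I_α -> U) :=
  [set u | exists2 u', X u' & forall j, j <> i -> u j = u' j].

Definition diagonal (α : nat) (U : Type) (i j : 'I_α) : set ('I_α -> U) :=
  [set u | u i = u j].

(* The indices 0 and 1 are the (unique, when 1 < α) i0 and i1 in 'I_α with
   these values, so that no proof of 1 < α is needed in the definition. *)
Definition P01 (α : nat) (U : Type) (X : set ('I_α -> U)) :
    set ('I_α -> U) :=
  [set u | exists2 u', X u' &
    [/\ forall i0 i1 : 'I_α, i0 = 0 :> nat -> i1 = 1 :> nat -> u i0 = u' i1,
        forall i0 i1 : 'I_α, i0 = 0 :> nat -> i1 = 1 :> nat -> u i1 = u' i0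
      & forall l : 'I_α, l <> 0 :> nat -> l <> 1 :> nat -> u l = u' l]].

Record set_universe (α : nat) (U : Type) (A : set (set ('I_α -> U))) : Prop :=
  SetUniverse {
    universe_diag : forall i j, A (@diagonal α U i j);
    universe_union : forall X Y, A X -> A Y -> A (X `|` Y);
    universe_compl : forall X, A X -> A (~` X);
    universe_cyl : forall i X, A X -> A (cylinder i X);
    universe_P01 : forall X, A X -> A (P01 X) }.

Definition set_algebra (α : nat) (U : Type) (A : set (set ('I_α -> U)))
    (hA : set_universe A) : algebra α :=
  @Algebra α {X : set ('I_α -> U) | A X}
    (fun X Y => exist A _ (universe_union hA (svalP X) (svalP Y)))
    (fun X => exist A _ (universe_compl hA (svalP X)))
    (fun i X => exist A _ (universe_cyl hA i (svalP X)))
    (fun i j => exist A _ (universe_diag hA i j))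
    (fun X => exist A _ (universe_P01 hA (svalP X))).

Inductive set_algebras (α : nat) : algebra α -> Prop :=
| SetAlgebras (U : Type) (A : set (set ('I_α -> U))) (hA : set_universe A) :
    set_algebras (set_algebra hA).

(* Main.v *)
From mathcomp Require Import all_boot fingroup perm ssralg zmodp.
From mathcomp Require Import boolp classical_sets functions cardinality.
Require Import Defs.

Set Implicit Arguments.
Unset Strict Implicit.
Unset Printing Implicit Defensive.

Local Open Scope classical_set_scope.

(** Suppose that only finitely many occurrences of p01 are used, so that the
    axioms containing p01 have at most m variables in all. One algebra, depending
    on m, satisfies all these axioms and all valid equations without p01, but
    refutes a valid equation.

    The obstruction is the fact that a complete graph with an odd number N + 1
    of vertices has no one-factorization, i.e. no colouring of its edges with N
    colours such that every vertex meets every colour ([no_edge_coloring]).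
    Without symmetry the problem disappears: the N nonzero differences modulo
    N + 1 colour the ordered pairs of distinct vertices so that each colour
    occurs in every row and every column. With much fewer colours it
    disappears as well: x + y modulo Q is a symmetric colouring in which
    every vertex meets all Q colours as soon as N + 1 > 2Q.

    The base consists of N + 1 vertices, of all their enumerations, and of N
    further points for every coordinate. The edges are the tuples with distinct
    vertices at the coordinates 0 and 1 and a further point of sort i at each
    coordinate i > 1. They form one orbit of the group that permutes vertices
    and further points, hence an atom of the algebra of invariant relations. The
    coloured algebra splits this atom formally into N parts, as if each part
    met every line in every direction and were fixed by p01
    ([coloured_algebra]). A colouring of the edges that meets all colours on
    every line represents the cylindric part, and represents p01 too if it is
    symmetric ([eval_pull], [coloured_equation]).

    So the equations without p01 hold, by the colouring with differences
    ([p01_free_valid]). The values of m variables distinguish at most Q = 2^m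
    classes of colours, and only these classes have to occur on every line; with
    N = 2Q the symmetric colouring with sums does this, so valid equations with
    at most m variables hold ([few_variables_valid]). But all N parts together
    describe a one-factorization of an odd complete graph. The enumerations make
    this visible to the algebra: a single enumeration names the vertices
    injectively by N + 1 labels, which bounds their number. This is the
    valid equation that fails ([factorization_equation]). *)

(** * Edge colourings of complete graphs of odd order *)

(** An involution without fixed points exchanges the k with k < f k and the k
    with f k < k. *)
Lemma odd_card_fixpoint (m : nat) (f : 'I_m -> 'I_m) :
  odd m -> (forall k, f (f k) = k) -> exists k, f k = k.
Proof.
move=> odd_m ff; apply: contrapT => nofix.
have fk k : f k != k by apply/eqP => e; apply: nofix; exists k.
pose B : {set 'I_m} := [set k : 'I_m | k < f k]%SET.
have imB : (f @: B = ~: B)%SET.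
  apply/setP => k; rewrite !inE -leqNgt leq_eqVlt (inj_eq val_inj) (negPf (fk k)) /=.
  apply/imsetP/idP => [[l]|lt_k].
    by rewrite inE => lt_l ->; rewrite ff.
  by exists (f k); rewrite ?inE ff.
have := cardsC B; rewrite -imB card_imset ?addnn ?card_ord; last first.
  exact: can_inj ff.
by move=> em; move: odd_m; rewrite -em odd_double.
Qed.

(** The N neighbours of a vertex along the N relations are distinct and exhaust
    the other vertices, because there are at most N + 1 labels. So each
    relation is a perfect matching, which an odd number of vertices forbids. *)
Lemma no_edge_coloring (N : nat) (T : Type) (K : set T) (lab : T -> 'I_N.+1)
    (e : 'I_N -> T -> T -> Prop) :
  0 < N -> ~~ odd N ->
  K !=set0 ->
  (forall y z, K y -> K z -> lab y = lab z -> y = z) ->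
  (forall j y, K y -> exists2 z, K z & e j y z) ->
  (forall j y z, e j y z -> e j z y) ->
  (forall j y, ~ e j y y) ->
  (forall i j y z, e i y z -> e j y z -> i = j) ->
  False.
Proof.
move=> N_gt0 evN [y0 Ky0] lab_inj e_ex e_sym e_irr e_disj.
have /choice [nb nbP] (p : 'I_N * T) :
    exists z, K p.2 -> K z /\ e p.1 p.2 z.
  case: p => j y /=; have [Ky|nKy] := pselect (K y); last by exists y.
  by have [z Kz ejz] := e_ex j y Ky; exists z.
(* A vertex and its N neighbours carry N + 1 different labels, hence all. *)
have star z : K z -> forall k, exists o : option 'I_N,
    lab (if o is Some j then nb (j, z) else z) = k.
  move=> Kz k.
  pose g (o : option 'I_N) := lab (if o is Some j then nb (j, z) else z).
  have g_inj : injective g.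
    move=> [i|] [j|] //= /lab_inj.
    - have [Ki ei] := nbP (i, z) Kz; have [Kj ej] := nbP (j, z) Kz.
      by move=> /(_ Ki Kj) eij; rewrite -eij in ej; congr Some; exact: e_disj ei ej.
    - have [Ki ei] := nbP (i, z) Kz.
      by move=> /(_ Ki Kz) eij; rewrite eij in ei; case: (e_irr _ _ ei).
    - have [Kj ej] := nbP (j, z) Kz.
      by move=> /(_ Kz Kj) eij; rewrite -eij in ej; case: (e_irr _ _ ej).
  have /codomP [o ->] : k \in codom g.
    by apply: inj_card_onto g_inj _ k; rewrite card_option !card_ord.
  by exists o.
have /choice [pt ptP] (k : 'I_N.+1) : exists y, K y /\ lab y = k.
  have [[j|] lk] := star y0 Ky0 k.
    by exists (nb (j, y0)); split=> //; have [] := nbP (j, y0) Ky0.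
  by exists y0.
pose j0 := Ordinal N_gt0.
pose f k := lab (nb (j0, pt k)).
have nbnb y : K y -> nb (j0, nb (j0, y)) = y.
  move=> Ky; have [Kz /= ez] := nbP (j0, y) Ky.
  have [Kz' /= ez'] := nbP (j0, nb (j0, y)) Kz.
  have [[i|] /= /lab_inj E] := star _ Kz (lab y); last first.
    by move: ez; rewrite (E Kz Ky) => /e_irr.
  have [Ki /= ei] := nbP (i, nb (j0, y)) Kz.
  rewrite (E Ki Ky) in ei.
  have ij : i = j0 := e_disj _ _ _ _ ei (e_sym _ _ _ ez).
  by rewrite ij in E Ki; apply: E.
have ptlab y : K y -> pt (lab y) = y.
  by move=> Ky; have [Kp lp] := ptP (lab y); apply: lab_inj.
have [] := @odd_card_fixpoint N.+1 f.
- by rewrite /= evN.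
- move=> k; have [Kk lk] := ptP k; have [Kz _] := nbP (j0, pt k) Kk.
  by rewrite /f ptlab // nbnb.
- move=> k fk; have [Kk lk] := ptP k; have [Kz ez] := nbP (j0, pt k) Kk.
  have E : nb (j0, pt k) = pt k by apply: lab_inj; rewrite ?lk.
  by move: ez; rewrite E => /e_irr.
Qed.

(** * Equational logic *)

Lemma eval_subst (α : nat) (B : algebra α) (v : nat -> carrier B)
    (f : nat -> term α) (t : term α) :
  eval v (subst f t) = eval (fun n => eval v (f n)) t.
Proof. by elim: t => //= [s -> t ->|s ->|i s ->|s ->]. Qed.

Lemma derivable_sound (α : nat) (E : set (equation α)) (B : algebra α) :
  (forall s t, E (s, t) -> forall v : nat -> carrier B, eval v s = eval v t) ->
  forall s t, derivable E s t -> forall v : nat -> carrier B, eval v s = eval v t.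
Proof.
move=> sE s t; elim=> {s t}.
- exact: sE.
- by [].
- by move=> s t _ IH v; rewrite IH.
- by move=> s t r _ IH1 _ IH2 v; rewrite IH1.
- by move=> f s t _ IH v; rewrite !eval_subst.
- by move=> s s' t t' _ IH1 _ IH2 v /=; rewrite IH1 IH2.
- by move=> s s' _ IH v /=; rewrite IH.
- by move=> i s s' _ IH v /=; rewrite IH.
- by move=> s s' _ IH v /=; rewrite IH.
Qed.

Fixpoint var_bound (α : nat) (t : term α) : nat :=
  match t with
  | Var n => n.+1
  | Plus t1 t2 => maxn (var_bound t1) (var_bound t2)
  | Minus t1 => var_bound t1
  | Cyl _ t1 => var_bound t1
  | Diag _ _ => 0
  | Perm t1 => var_bound t1
  end.

(** Finitely many occurrences lie in finitely many equations. *)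
Lemma p01_variables_bounded (α : nat) (E : set (equation α)) :
  p01_occurs_finitely E ->
  exists n, forall e, E e -> 0 < eq_occ_p01 e ->
    maxn (var_bound e.1) (var_bound e.2) <= n.
Proof.
move=> /(finite_image (fun ek : equation α * nat =>
  maxn (var_bound ek.1.1) (var_bound ek.1.2))) /finite_seqP [s sE].
exists (\max_(k <- s) k) => e Ee occ_e.
set k := maxn _ _; have : k \in s.
  suff : [set` s] k by [].
  by rewrite -sE; exists (e, 0).
by move=> ks; apply: (@leq_bigmax_seq _ _ xpredT id).
Qed.

(** * Algebras of sets *)

(** Both the full set algebras and the coloured algebras below are Boolean
    algebras of sets with three further operations. *)
Definition boolean_set_algebra (α : nat) (T : Type)
    (c : 'I_α -> set T -> set T) (d : 'I_α -> 'I_α -> set T)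
    (p : set T -> set T) : algebra α :=
  @Algebra α (set T) setU setC c d p.

Definition full_algebra (α : nat) (U : Type) : algebra α :=
  boolean_set_algebra (@cylinder α U) (@diagonal α U) (@P01 α U).

Lemma sval_inj (T : Type) (P : T -> Prop) (x y : {z | P z}) :
  sval x = sval y -> x = y.
Proof. by case: x y => [x hx] [y hy] /= exy; apply: eq_exist. Qed.

Lemma sval_eval (α : nat) (U : Type) (A : set (set ('I_α -> U)))
    (hA : set_universe A) (v : nat -> carrier (set_algebra hA)) (t : term α) :
  sval (eval v t) = eval (B := full_algebra α U) (fun n => sval (v n)) t.
Proof. by elim: t => //= [s -> t ->|s ->|i s ->|s ->]. Qed.

Lemma true_in_set_algebrasE (α : nat) (e : equation α) :
  true_in (@set_algebras α) e <->
  forall U (v : nat -> carrier (full_algebra α U)), eval v e.1 = eval v e.2.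
Proof.
split=> [te U v|te B [U A hA] v]; last first.
  by apply: (@sval_inj _ A); rewrite !sval_eval; apply: te.
have hT : set_universe [set: set ('I_α -> U)] by [].
have := te _ (SetAlgebras hT) (fun n => exist _ (v n) I).
by move=> /(congr1 sval); rewrite !sval_eval.
Qed.

(** * Coordinates *)

Definition i0 {n : nat} : 'I_n.+3 := @Ordinal n.+3 0 isT.
Definition i1 {n : nat} : 'I_n.+3 := @Ordinal n.+3 1 isT.
Definition i2 {n : nat} : 'I_n.+3 := @Ordinal n.+3 2 isT.

Definition upd (α : nat) (U : Type) (u : 'I_α -> U) (i : 'I_α) (y : U) : 'I_α -> U :=
  fun j => if j == i then y else u j.

Definition swap01 (n : nat) (U : Type) (u : 'I_n.+3 -> U) : 'I_n.+3 -> U :=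
  fun j => u (tperm i0 i1 j).

Lemma cylinderE (α : nat) (U : Type) (i : 'I_α) (X : set ('I_α -> U)) u :
  cylinder i X u <-> exists y, X (upd u i y).
Proof.
split=> [[u' Xu' e]|[y Xy]]; last first.
  by exists (upd u i y) => // j /eqP/negPf ji; rewrite /upd ji.
exists (u' i); suff -> : upd u i (u' i) = u' by [].
by apply/funext => j; rewrite /upd; case: eqP => [->|/e].
Qed.

Lemma P01E (n : nat) (U : Type) (X : set ('I_n.+3 -> U)) u :
  P01 X u <-> X (swap01 u).
Proof.
split=> [[u' Xu' [e0 e1 el]]|Xu].
  suff -> : swap01 u = u' by [].
  apply/funext => j; rewrite /swap01.
  case: tpermP => [->|->|n0 n1]; [exact: e1|exact: e0|].
  by apply: el => jE; [apply: n0|apply: n1]; apply: val_inj.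
exists (swap01 u) => //; split=> [j0 j1 /= e0 e1|j0 j1 /= e0 e1|l l0 l1].
- have -> : j0 = i0 by apply: val_inj.
  have -> : j1 = i1 by apply: val_inj.
  by rewrite /swap01 tpermR.
- have -> : j0 = i0 by apply: val_inj.
  have -> : j1 = i1 by apply: val_inj.
  by rewrite /swap01 tpermL.
- rewrite /swap01 tpermD //.
    by apply/eqP => e; apply: l0; rewrite -e.
  by apply/eqP => e; apply: l1; rewrite -e.
Qed.

Lemma updK (α : nat) (U : Type) (u : 'I_α -> U) i : upd u i (u i) = u.
Proof. by apply/funext => j; rewrite /upd; case: eqP => [->|]. Qed.

Lemma upd_upd (α : nat) (U : Type) (u : 'I_α -> U) i y z :
  upd (upd u i y) i z = upd u i z.
Proof. by apply/funext => j; rewrite /upd; case: eqP. Qed.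

Lemma upd_comm (α : nat) (U : Type) (u : 'I_α -> U) i j y z : i != j ->
  upd (upd u i y) j z = upd (upd u j z) i y.
Proof.
move=> ij; apply/funext => k; rewrite /upd.
by case: eqP => // ->; rewrite eq_sym (negPf ij).
Qed.

Lemma swap01_upd (n : nat) (U : Type) (u : 'I_n.+3 -> U) y z :
  swap01 (upd (upd u i0 y) i1 z) = upd (upd u i0 z) i1 y.
Proof.
apply/funext => j; rewrite /swap01 /upd.
case: tpermP => [->|->|/eqP/negPf -> /eqP/negPf ->] //.
Qed.

(** * An equation about one-factorizations *)

Definition tdiff (α : nat) (s t : term α) : term α := Minus (Plus (Minus s) t).

Definition tmeet (α : nat) (s t : term α) : term α := tdiff s (Minus t).

Fixpoint tjoin (n m : nat) (F : nat -> term n.+3) : term n.+3 :=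
  if m is m'.+1 then Plus (tjoin m' F) (F m')
  else tdiff (Diag i0 i0) (Diag i0 i0).

Definition tsomewhere (α : nat) (t : term α) : term α :=
  foldr (fun i s => Cyl i s) t (enum 'I_α).

(** The intended reading: x 0, ..., x (N - 1) are disjoint symmetric irreflexive
    relations between the coordinates 0 and 1, each meeting every line of
    direction 0 that another one meets; b k holds if the object at coordinate 0
    gives the label k to the object at coordinate 1. [labels_cover] says that an
    object which gives the label 0 to something labels all vertices, and [label_i2] makes b k
    independent of coordinate 2, so that [label_inj] can compare two vertices
    with the same label. *)
Record factorization (n N : nat) (T : Type)
    (c : 'I_n.+3 -> set T -> set T) (d : 'I_n.+3 -> 'I_n.+3 -> set T)
    (p : set T -> set T) (x b : nat -> set T) : Prop := Factorization {
  factor_spanning : forall i, i < N -> forall j, j < N -> x i `<=` c i0 (x j);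
  factor_disjoint : forall i, i < N -> forall j, j < N -> i <> j -> x i `<=` ~` x j;
  factor_symmetric : forall j, j < N -> p (x j) `<=` x j;
  factor_irreflexive : forall j, j < N -> x j `<=` ~` d i0 i1;
  labels_exist : x 0 `<=` c i0 (c i1 (b 0));
  labels_cover : c i1 (b 0) `&` c i0 (x 0) `<=` \bigcup_(k in [set k | k < N.+1]) b k;
  label_i2 : forall k, k < N.+1 -> c i2 (b k) `<=` b k;
  label_inj : forall k, k < N.+1 -> b k `&` c i1 (d i1 i2 `&` b k) `<=` d i1 i2 }.

(** Zero exactly when the inclusions of [factorization] hold; even variables
    stand for the relations and odd ones for the labels. *)
Definition tviolation (n N : nat) : term n.+3 :=
  let x j := @Var n.+3 j.*2 in
  let b k := @Var n.+3 k.*2.+1 in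
  Plus (tjoin N (fun i => tjoin N (fun j => tdiff (x i) (Cyl i0 (x j)))))
 (Plus (tjoin N (fun i => tjoin N (fun j =>
          if i == j then tdiff (x i) (x i) else tdiff (x i) (Minus (x j)))))
 (Plus (tjoin N (fun j => tdiff (Perm (x j)) (x j)))
 (Plus (tjoin N (fun j => tdiff (x j) (Minus (Diag i0 i1))))
 (Plus (tdiff (x 0) (Cyl i0 (Cyl i1 (b 0))))
 (Plus (tdiff (tmeet (Cyl i1 (b 0)) (Cyl i0 (x 0))) (tjoin N.+1 b))
 (Plus (tjoin N.+1 (fun k => tdiff (Cyl i2 (b k)) (b k)))
       (tjoin N.+1 (fun k =>
          tdiff (tmeet (b k) (Cyl i1 (tmeet (Diag i1 i2) (b k)))) (Diag i1 i2))))))))).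

(** The equation form of: if nothing violates the factorization conditions,
    then x 0 is empty. *)
Definition factorization_equation (n N : nat) : equation n.+3 :=
  (Plus (Var 0) (tsomewhere (tviolation n N)), tsomewhere (tviolation n N)).

Definition is_empty (α : nat) (T : Type) c d p
    (v : nat -> carrier (@boolean_set_algebra α T c d p)) (t : term α) : Prop :=
  (eval v t : set T) = set0.

Lemma eval_tdiff (α : nat) (T : Type) c d p
    (v : nat -> carrier (@boolean_set_algebra α T c d p)) (s t : term α) :
  eval v (tdiff s t) = (eval v s : set T) `\` (eval v t : set T).
Proof. by rewrite /= setCU setCK setDE. Qed.

Lemma eval_tmeet (α : nat) (T : Type) c d p
    (v : nat -> carrier (@boolean_set_algebra α T c d p)) (s t : term α) :
  eval v (tmeet s t) = (eval v s : set T) `&` (eval v t : set T).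
Proof. by rewrite eval_tdiff /= setDE setCK. Qed.

Lemma eval_tjoin (n m : nat) (T : Type) c d p
    (v : nat -> carrier (@boolean_set_algebra n.+3 T c d p)) (F : nat -> term n.+3) :
  eval v (tjoin m F) = \bigcup_(k in [set k | k < m]) (eval v (F k) : set T).
Proof.
elim: m => [|m IH].
  by rewrite [tjoin _ _]/= eval_tdiff setDv; apply/esym; rewrite -subset0 => z [].
rewrite /= {}IH; apply/seteqP; split=> [z [[k /= km kz]|mz]|z [k /=]].
- by exists k => //=; apply: leqW.
- by exists m => /=.
- by rewrite ltnS leq_eqVlt => /orP[/eqP->|km]; [right|left; exists k].
Qed.

Lemma is_empty_plus (α : nat) (T : Type) c d p
    (v : nat -> carrier (@boolean_set_algebra α T c d p)) (s t : term α) :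
  is_empty v (Plus s t) <-> is_empty v s /\ is_empty v t.
Proof. by rewrite /is_empty [X in X <-> _]setU_eq0. Qed.

Lemma is_empty_tdiff (α : nat) (T : Type) c d p
    (v : nat -> carrier (@boolean_set_algebra α T c d p)) (s t : term α) :
  is_empty v (tdiff s t) <-> (eval v s : set T) `<=` eval v t.
Proof. by rewrite /is_empty eval_tdiff; by rewrite setD_eq0. Qed.

Lemma is_empty_tjoin (n m : nat) (T : Type) c d p
    (v : nat -> carrier (@boolean_set_algebra n.+3 T c d p)) (F : nat -> term n.+3) :
  is_empty v (tjoin m F) <-> forall k, k < m -> is_empty v (F k).
Proof.
rewrite /is_empty eval_tjoin; split=> [E k km|E].
  by rewrite -subset0 => z Fz; rewrite -E; exists k.
by rewrite -subset0 => z [k km]; rewrite E.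
Qed.

Lemma is_empty_tviolation (n N : nat) (T : Type) c d p
    (v : nat -> carrier (@boolean_set_algebra n.+3 T c d p)) :
  is_empty v (tviolation n N) <->
  factorization N c d p (fun j => v j.*2) (fun k => v k.*2.+1).
Proof.
have eval_label k : eval v (tmeet (Var k) (Cyl i1 (tmeet (Diag i1 i2) (Var k)))) =
    (v k : set T) `&` c i1 (d i1 i2 `&` (v k : set T)).
  rewrite eval_tmeet; congr (_ `&` c i1 _).
  exact: (eval_tmeet v (Diag i1 i2) (Var k)).
split.
  case/is_empty_plus=> /is_empty_tjoin h1 /is_empty_plus[/is_empty_tjoin h2].
  case/is_empty_plus=> /is_empty_tjoin h3 /is_empty_plus[/is_empty_tjoin h4].
  case/is_empty_plus=> /is_empty_tdiff h5 /is_empty_plus[/is_empty_tdiff h6].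
  case/is_empty_plus=> /is_empty_tjoin h7 /is_empty_tjoin h8.
  split=> //.
  - by move=> i iN j jN; have /is_empty_tjoin /(_ j jN) /is_empty_tdiff := h1 i iN.
  - move=> i iN j jN /eqP/negPf ij; have /is_empty_tjoin /(_ j jN) := h2 i iN.
    by rewrite ij => /is_empty_tdiff.
  - by move=> j /h3/is_empty_tdiff.
  - by move=> j /h4/is_empty_tdiff.
  - by move: h6; rewrite eval_tmeet eval_tjoin.
  - by move=> j /h7/is_empty_tdiff.
  - by move=> j /h8/is_empty_tdiff; rewrite eval_label.
case=> h1 h2 h3 h4 h5 h6 h7 h8.
apply/is_empty_plus; split.
  apply/is_empty_tjoin => i iN; apply/is_empty_tjoin => j jN.
  by apply/is_empty_tdiff; apply: h1.
apply/is_empty_plus; split.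
  apply/is_empty_tjoin => i iN; apply/is_empty_tjoin => j jN.
  by case: eqP => [->|ij]; apply/is_empty_tdiff => //; apply: h2.
apply/is_empty_plus; split.
  by apply/is_empty_tjoin => j jN; apply/is_empty_tdiff; apply: h3.
apply/is_empty_plus; split.
  by apply/is_empty_tjoin => j jN; apply/is_empty_tdiff; apply: h4.
apply/is_empty_plus; split; first by apply/is_empty_tdiff; apply: h5.
apply/is_empty_plus; split.
  by apply/is_empty_tdiff; rewrite eval_tmeet eval_tjoin; apply: h6.
apply/is_empty_plus; split; apply/is_empty_tjoin => k kN; apply/is_empty_tdiff.
  exact: h7.
by rewrite eval_label; apply: h8.
Qed.

(** From a tuple u in x 0, the vertices are the possible values at coordinate 1
    when the coordinates from 2 on are those of u. A single object p labels all of
    them, and the relations x j between them form a one-factorization of an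
    odd complete graph. *)
Lemma full_factorization_empty (n N : nat) (U : Type)
    (x b : nat -> set ('I_n.+3 -> U)) :
  0 < N -> ~~ odd N ->
  factorization N (@cylinder n.+3 U) (@diagonal n.+3 U) (@P01 n.+3 U) x b ->
  x 0 = set0.
Proof.
move=> N_gt0 evN [spanning disjoint symmetric irreflexive exist cover label_i2 label_inj].
rewrite -subset0 => u xu.
have /cylinderE[p /cylinderE[t bt]] := exist u xu.
pose pt z y := upd (upd u i0 z) i1 y.
have pt0 z y z' : upd (pt z y) i0 z' = pt z' y.
  by rewrite /pt upd_comm // upd_upd.
have pt1 z y y' : upd (pt z y) i1 y' = pt z y' by rewrite /pt upd_upd.
pose K : set U := [set y | exists z, x 0 (pt z y)].
have /choice[lab labP] (y : U) : exists k : 'I_N.+1, K y -> b k (pt p y).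
  have [[z xzy]|nKy] := pselect (K y); last by exists ord0.
  have [|k /= kN bk] := cover (pt p y); last by exists (Ordinal kN).
  split; apply/cylinderE; first by exists t; rewrite pt1.
  by exists z; rewrite pt0.
have e_sym (j : 'I_N) y z : x j (pt y z) -> x j (pt z y).
  by move=> xj; apply: symmetric => //; apply/P01E; rewrite swap01_upd.
apply: (@no_edge_coloring N U K lab (fun j y z => x j (pt y z))) => //.
- by exists (u i1), (u i0); rewrite /pt updK updK.
- move=> y y' Ky Ky' labE.
  (* The tuple with y at coordinate 1 and y' at coordinate 2 shows both labels. *)
  have bk2 s s' : K s -> lab s = lab y -> b (lab y) (upd (pt p s) i2 s').
    move=> Ks ls; apply: label_i2 => //; apply/cylinderE; exists (pt p s i2).
    by rewrite upd_upd updK -ls; apply: labP.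
  apply: (label_inj (lab y) (ltn_ord _) (upd (pt p y) i2 y')).
  split; first exact: bk2.
  apply/cylinderE; exists y'; split => //.
  by rewrite upd_comm // pt1; apply: bk2.
- move=> j y [z0 /(spanning 0 N_gt0 j (ltn_ord j))/cylinderE[z]].
  rewrite pt0 => /e_sym xyz; exists z => //.
  have /cylinderE[z'] := spanning _ (ltn_ord j) _ N_gt0 _ xyz.
  by rewrite pt0; exists z'.
- by move=> j y /irreflexive; apply.
- move=> i j y z xi xj; apply: contrapT => ij.
  apply: (disjoint i (ltn_ord i) j (ltn_ord j) _ _ xi xj).
  by move=> /val_inj.
Qed.

(** The cylindrifications of all coordinates send every nonempty set to the
    unit; this turns an implication between equations into one equation. *)
Lemma eval_tsomewhere_full (α : nat) (U : Type)
    (v : nat -> carrier (full_algebra α U)) (t : term α) u u' :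
  eval v t u -> eval v (tsomewhere t) u'.
Proof.
move=> tu; suff H (l : seq 'I_α) w :
    (forall i, i \notin l -> w i = u i) -> eval v (foldr (fun i s => Cyl i s) t l) w.
  by apply: H => i; rewrite mem_enum.
elim: l w => [|i l IH] w wu /=.
  by have -> : w = u by apply/funext => i; apply: wu.
apply/cylinderE; exists (u i); apply: IH => j jl; rewrite /upd.
by case: eqP => [->//|/eqP ji]; apply: wu; rewrite inE negb_or ji.
Qed.

Lemma eval_tsomewhere_empty (α : nat) (T : Type) c d p
    (v : nat -> carrier (@boolean_set_algebra α T c d p)) (t : term α) :
  (forall i, c i set0 = set0) -> is_empty v t -> is_empty v (tsomewhere t).
Proof.
rewrite /tsomewhere /is_empty => c0 t0.
by elim: (enum _) => [|i l IH] //=; rewrite IH.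
Qed.

Lemma factorization_equation_valid (n N : nat) : 0 < N -> ~~ odd N ->
  true_in (@set_algebras n.+3) (factorization_equation n N).
Proof.
move=> N_gt0 evN; apply/true_in_set_algebrasE => U v.
have [/is_empty_tviolation/full_factorization_empty x0|/eqP/set0P[u vu]] :=
  pselect (is_empty v (tviolation n N)).
  by rewrite /= x0 // set0U.
have -> : eval v (factorization_equation n N).2 = setT.
  by apply/seteqP; split=> // u' _; apply: eval_tsomewhere_full vu.
apply/seteqP; split=> // u' _; right; exact: eval_tsomewhere_full vu.
Qed.

Lemma factorization_equation_fails (n N : nat) (T : Type) c d p
    (v : nat -> carrier (@boolean_set_algebra n.+3 T c d p)) :
  (forall i, c i set0 = set0) ->
  factorization N c d p (fun j => v j.*2) (fun k => v k.*2.+1) ->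
  eval v (factorization_equation n N).1 = eval v (factorization_equation n N).2 ->
  (v 0 : set T) = set0.
Proof.
move=> c0 /is_empty_tviolation /(eval_tsomewhere_empty c0) h0.
move: h0; rewrite /is_empty /= => ->.
by rewrite setU0.
Qed.

(** * Coloured algebras *)

(** [Lbl p] is the enumeration p of the vertices [Pt k]; [Aux i w] are the points
    allowed at coordinate i of an edge. The enumerations allow labels without
    breaking the symmetry between the vertices. *)
Inductive point (α N : nat) : Type :=
| Pt of 'I_N.+1
| Lbl of {perm 'I_N.+1}
| Aux of 'I_α & 'I_N.

Arguments Pt {α N}.
Arguments Lbl {α N}.
Arguments Aux {α N}.

Definition act (α N : nat) (σ : {perm 'I_N.+1}) (τ : 'I_α -> {perm 'I_N})
    (y : point α N) : point α N :=
  match y with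
  | Pt k => Pt (σ k)
  | Lbl p => Lbl (p * σ)%g
  | Aux i w => Aux i (τ i w)
  end.

Lemma actK (α N : nat) (σ : {perm 'I_N.+1}) (τ : 'I_α -> {perm 'I_N}) :
  cancel (act σ^-1%g (fun i => (τ i)^-1%g)) (act σ τ).
Proof. by case=> [k|p|i w] /=; rewrite ?permKV // mulgKV. Qed.

Lemma act_inj (α N : nat) (σ : {perm 'I_N.+1}) (τ : 'I_α -> {perm 'I_N}) :
  injective (act σ τ).
Proof.
by move=> [k|p|i w] [k'|p'|i' w'] //= [] => [/perm_inj->|/mulIg->|-> /perm_inj->].
Qed.

Definition tup (n N : nat) (x y : 'I_N.+1) (w : 'I_n.+3 -> 'I_N) :
    'I_n.+3 -> point n.+3 N :=
  fun i => if i == i0 then Pt x else if i == i1 then Pt y else Aux i (w i).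

Definition edges (n N : nat) : set ('I_n.+3 -> point n.+3 N) :=
  [set u | exists x y w, x != y /\ u = tup x y w].

Lemma edges_transitive (n N : nat) (u u' : 'I_n.+3 -> point n.+3 N) :
  edges u -> edges u' -> exists σ τ, u' = act σ τ \o u.
Proof.
move=> [x [y [w [xy ->]]]] [x' [y' [w' [xy' ->]]]].
exists (tperm x x' * tperm (tperm x x' y) y')%g, (fun i => tperm (w i) (w' i)).
apply/funext => i; rewrite /tup /=; case: eqP => _ /=.
  rewrite permM tpermL (@tpermD _ _ y' x') //; last by rewrite eq_sym.
  apply: contra xy => /eqP E; apply/eqP/(@perm_inj _ (tperm x x')).
  by rewrite tpermL E.
by case: eqP => _ /=; rewrite ?permM tpermL.
Qed.

Lemma swap01_tup (n N : nat) (x y : 'I_N.+1) (w : 'I_n.+3 -> 'I_N) :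
  swap01 (tup x y w) = tup y x w.
Proof.
apply/funext => j; rewrite /swap01 /tup.
by case: tpermP => [->|->|/eqP/negPf -> /eqP/negPf ->].
Qed.

Lemma edges_swap01 (n N : nat) (u : 'I_n.+3 -> point n.+3 N) :
  edges u -> edges (swap01 u).
Proof.
by move=> [x [y [w [xy ->]]]]; exists y, x, w; rewrite swap01_tup eq_sym.
Qed.

Lemma swap01K (n : nat) (U : Type) : involutive (@swap01 n U).
Proof. by move=> u; apply/funext => j; rewrite /swap01 tpermK. Qed.

(** A pair (u, c) is the tuple u with the colour c. *)
Definition coloured_tuple (n N : nat) : Type :=
  (('I_n.+3 -> point n.+3 N) * 'I_N)%type.

(** Colours are visible on edges only; there they stand for the parts of the
    split atom. *)
Record admissible (n N : nat) (Z : set (coloured_tuple n N)) : Prop := Admissible {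
  admissible_act : forall σ τ u c, Z (u, c) -> Z (act σ τ \o u, c);
  admissible_colour : forall u c c', ~ edges u -> Z (u, c) -> Z (u, c') }.

(** A cylindrification forgets the colour: every part of the atom is meant to
    meet every line. *)
Definition ccyl (n N : nat) (i : 'I_n.+3) (Z : set (coloured_tuple n N)) :
    set (coloured_tuple n N) :=
  [set z | cylinder i [set u | exists c, Z (u, c)] z.1].

Definition cdiag (n N : nat) (i j : 'I_n.+3) : set (coloured_tuple n N) :=
  [set z | diagonal i j z.1].

(** The colour is kept, so every part of the atom is fixed. *)
Definition cP01 (n N : nat) (Z : set (coloured_tuple n N)) :
    set (coloured_tuple n N) :=
  [set z | P01 [set u | Z (u, z.2)] z.1].

Lemma admissibleU (n N : nat) (Z Z' : set (coloured_tuple n N)) :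
  admissible Z -> admissible Z' -> admissible (Z `|` Z').
Proof.
move=> [Za Zc] [Za' Zc']; split=> [σ τ u c [/Za|/Za']|u c c' nu [|]].
- by left.
- by right.
- by move=> /(Zc _ _ c' nu); left.
- by move=> /(Zc' _ _ c' nu); right.
Qed.

Lemma admissibleC (n N : nat) (Z : set (coloured_tuple n N)) :
  admissible Z -> admissible (~` Z).
Proof.
move=> [Za Zc]; split=> [σ τ u c nZ Zu|u c c' nu nZ Zu]; apply: nZ; last first.
  exact: Zc Zu.
have -> : u = act σ^-1%g (fun i => (τ i)^-1%g) \o (act σ τ \o u); last exact: Za.
by apply/funext => i /=; apply: (@act_inj _ _ σ τ); rewrite actK.
Qed.

Lemma admissible_ccyl (n N : nat) (i : 'I_n.+3) (Z : set (coloured_tuple n N)) :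
  admissible Z -> admissible (ccyl i Z).
Proof.
move=> [Za Zc]; split=> // σ τ u c [u' [c' Zu'] uu'].
by exists (act σ τ \o u') => [|j ji /=]; [exists c'; apply: Za|rewrite -uu'].
Qed.

Lemma admissible_cdiag (n N : nat) (i j : 'I_n.+3) : admissible (@cdiag n N i j).
Proof. by split=> // σ τ u c; rewrite /cdiag /diagonal /= => ->. Qed.

Lemma admissible_cP01 (n N : nat) (Z : set (coloured_tuple n N)) :
  admissible Z -> admissible (cP01 Z).
Proof.
move=> [Za Zc]; split=> [σ τ u c /P01E Zu|u c c' nu /P01E Zu]; apply/P01E.
  exact: Za Zu.
by apply: Zc Zu => /edges_swap01; rewrite swap01K.
Qed.

Definition coloured_algebra (n N : nat) : algebra n.+3 :=
  @Algebra n.+3 {Z : set (coloured_tuple n N) | admissible Z}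
    (fun Z Z' => exist _ _ (admissibleU (svalP Z) (svalP Z')))
    (fun Z => exist _ _ (admissibleC (svalP Z)))
    (fun i Z => exist _ _ (admissible_ccyl i (svalP Z)))
    (fun i j => exist _ _ (admissible_cdiag N i j))
    (fun Z => exist _ _ (admissible_cP01 (svalP Z))).

Definition coloured_set_algebra (n N : nat) : algebra n.+3 :=
  boolean_set_algebra (@ccyl n N) (@cdiag n N) (@cP01 n N).

Lemma sval_eval_coloured (n N : nat) (v : nat -> carrier (coloured_algebra n N))
    (t : term n.+3) :
  sval (eval v t) = eval (B := coloured_set_algebra n N) (fun k => sval (v k)) t.
Proof. by elim: t => //= [s -> t ->|s ->|i s ->|s ->]. Qed.

(** Edges form one orbit, so on edges an admissible set is a set of colours. *)
Lemma admissible_edges (n N : nat) (Z : set (coloured_tuple n N)) u u' c :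
  admissible Z -> edges u -> edges u' -> Z (u, c) -> Z (u', c).
Proof.
by move=> [Za _] eu eu' Zu; have [σ [τ ->]] := edges_transitive eu eu'; apply: Za.
Qed.

(** * Representations by edge colourings *)

(** A function ty on the colours identifies those that need not be told apart
    when only some elements of the algebra matter. *)
Definition type_invariant (n N : nat) (Ty : Type) (ty : 'I_N -> Ty)
    (Z : set (coloured_tuple n N)) : Prop :=
  forall u c c', ty c = ty c' -> Z (u, c) -> Z (u, c').

Definition every_line_coloured (n N : nat) (Ty : Type) (ty : 'I_N -> Ty)
    (f : ('I_n.+3 -> point n.+3 N) -> 'I_N) : Prop :=
  forall u i c, edges u -> exists2 y, edges (upd u i y) & ty (f (upd u i y)) = ty c.

Definition pull (n N : nat) (f : ('I_n.+3 -> point n.+3 N) -> 'I_N)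
    (Z : set (coloured_tuple n N)) : set ('I_n.+3 -> point n.+3 N) :=
  [set u | Z (u, f u)].

(** If the witness is an edge of the wrong colour, its line in direction i
    contains an edge with a colour of the right type, which serves as well. *)
Lemma pull_ccyl (n N : nat) (Ty : Type) (ty : 'I_N -> Ty) f i
    (Z : set (coloured_tuple n N)) :
  every_line_coloured ty f -> admissible Z -> type_invariant ty Z ->
  pull f (ccyl i Z) = cylinder i (pull f Z).
Proof.
move=> line aZ tZ; apply/seteqP; split=> u /cylinderE[y]; last first.
  by move=> Zy; apply/cylinderE; exists y, (f (upd u i y)).
move=> [c Zc]; apply/cylinderE.
have [ey|ney] := pselect (edges (upd u i y)); last first.
  by exists y; apply: (admissible_colour aZ) Zc.
have [y' ey' tyc] := line _ i c ey; exists y'.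
rewrite upd_upd in ey' tyc; apply: (tZ _ _ _ (esym tyc)).
exact: admissible_edges Zc.
Qed.

Lemma pull_inj (n N : nat) (Ty : Type) (ty : 'I_N -> Ty) f
    (Z Z' : set (coloured_tuple n N)) :
  every_line_coloured ty f ->
  admissible Z -> type_invariant ty Z -> admissible Z' -> type_invariant ty Z' ->
  pull f Z = pull f Z' -> Z = Z'.
Proof.
move=> line; suff sub Y Y' : admissible Y -> type_invariant ty Y ->
    admissible Y' -> type_invariant ty Y' -> pull f Y = pull f Y' -> Y `<=` Y'.
  by move=> aZ tZ aZ' tZ' ZZ'; apply/seteqP; split; apply: sub.
move=> aY tY aY' tY' YY' [u c] Yu.
have YY'f w : Y (w, f w) -> Y' (w, f w).
  by move=> Yw; have : pull f Y w by []; rewrite YY'.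
have [eu|neu] := pselect (edges u); last first.
  apply: (admissible_colour aY' _ neu); apply: YY'f.
  exact: (admissible_colour aY _ neu Yu).
have [y ey tyc] := line _ i0 c eu.
apply: (admissible_edges aY' ey eu); apply: (tY' _ _ _ tyc); apply: YY'f.
by apply: (tY _ _ _ (esym tyc)); apply: (admissible_edges aY eu ey Yu).
Qed.

(** Pulling back along f commutes with the cylindrifications by
    [pull_ccyl], and with p01 if f is symmetric. *)
Lemma eval_pull (n N : nat) (Ty : Type) (ty : 'I_N -> Ty)
    (f : ('I_n.+3 -> point n.+3 N) -> 'I_N)
    (v : nat -> carrier (coloured_algebra n N)) (t : term n.+3) :
  every_line_coloured ty f ->
  (forall k, k < var_bound t -> type_invariant ty (sval (v k))) ->
  (0 < occ_p01 t -> forall u, f (swap01 u) = f u) ->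
  type_invariant ty (sval (eval v t)) /\
  pull f (sval (eval v t)) =
    eval (B := full_algebra n.+3 (point n.+3 N)) (fun k => pull f (sval (v k))) t.
Proof.
move=> line; elim: t => [k|s IHs t IHt|s IHs|i s IHs|i j|s IHs] /= tv fsym.
- by split=> //; apply: tv.
- have [||ts ps] := IHs; first by move=> k ks; apply: tv; rewrite leq_max ks.
    by move=> os; apply: fsym; rewrite addn_gt0 os.
  have [||tt pt] := IHt; first by move=> k ks; apply: tv; rewrite leq_max ks orbT.
    by move=> os; apply: fsym; rewrite addn_gt0 os orbT.
  split; last by rewrite -ps -pt.
  by move=> u c c' cc' [/(ts _ _ _ cc')|/(tt _ _ _ cc')]; [left|right].
- have [ts ps] := IHs tv fsym; split; last by rewrite -ps.
  by move=> u c c' cc' nZ /(ts _ _ _ (esym cc')).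
- have [ts ps] := IHs tv fsym; split; first by [].
  by rewrite -ps; apply: pull_ccyl line _ ts; apply: svalP.
- by split=> // u c c' _.
- have [ts ps] := IHs tv (fun _ => fsym isT); split.
    by move=> u c c' cc' /P01E Zu; apply/P01E; apply: ts Zu.
  rewrite -ps; apply/seteqP; split=> u /P01E Zu; apply/P01E.
    by rewrite /pull /= fsym.
  by move: Zu; rewrite /pull /= fsym.
Qed.

Lemma coloured_equation (n N : nat) (Ty : Type) (ty : 'I_N -> Ty)
    (f : ('I_n.+3 -> point n.+3 N) -> 'I_N)
    (v : nat -> carrier (coloured_algebra n N)) (e : equation n.+3) :
  true_in (@set_algebras n.+3) e ->
  every_line_coloured ty f ->
  (forall k, k < maxn (var_bound e.1) (var_bound e.2) ->
    type_invariant ty (sval (v k))) ->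
  (0 < eq_occ_p01 e -> forall u, f (swap01 u) = f u) ->
  eval v e.1 = eval v e.2.
Proof.
move=> /true_in_set_algebrasE te line tv fsym; apply: (@sval_inj _ (@admissible n N)).
have [||t1 p1] := @eval_pull _ _ _ ty f v e.1 line.
- by move=> k ks; apply: tv; rewrite leq_max ks.
- by move=> os; apply: fsym; rewrite addn_gt0 os.
have [||t2 p2] := @eval_pull _ _ _ ty f v e.2 line.
- by move=> k ks; apply: tv; rewrite leq_max ks orbT.
- by move=> os; apply: fsym; rewrite addn_gt0 os orbT.
apply: (pull_inj line) => //; try exact: svalP.
by rewrite p1 p2; apply: te.
Qed.

Lemma residue (Q s k : nat) : k < Q -> exists2 z, z < Q & (z + s) %% Q = k.
Proof.
move=> kQ; have Q_gt0 : 0 < Q by apply: leq_ltn_trans kQ.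
exists ((k + (Q - s %% Q)) %% Q); first by rewrite ltn_mod.
rewrite modnDml -modnDmr -addnA subnK ?modnDr ?(modn_small kQ) //.
exact/ltnW/ltn_pmod.
Qed.

(** Each residue modulo Q has two representatives below 2Q, one of which avoids
    the given number. *)
Lemma residue_avoiding (Q s k x : nat) : k < Q ->
  exists z, [/\ z < Q.*2, z != x & (z + s) %% Q = k].
Proof.
move=> kQ; have [z zQ zk] := residue s kQ.
have [zx|zx] := eqVneq z x; last first.
  by exists z; split=> //; rewrite -addnn ltn_addr.
exists (z + Q); split; first by rewrite -addnn ltn_add2r.
  by rewrite -zx -[X in _ != X]addn0 eqn_add2l -lt0n; apply: leq_ltn_trans kQ.
by rewrite addnAC modnDr.
Qed.

Lemma upd_tup0 (n N : nat) (x y z : 'I_N.+1) (w : 'I_n.+3 -> 'I_N) :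
  upd (tup x y w) i0 (Pt z) = tup z y w.
Proof. by apply/funext => j; rewrite /upd /tup; case: eqP. Qed.

Lemma upd_tup1 (n N : nat) (x y z : 'I_N.+1) (w : 'I_n.+3 -> 'I_N) :
  upd (tup x y w) i1 (Pt z) = tup x z w.
Proof. by apply/funext => j; rewrite /upd /tup; case: eqP => [->|]. Qed.

Lemma upd_tup_aux (n N : nat) (x y : 'I_N.+1) (w : 'I_n.+3 -> 'I_N) i c :
  i != i0 -> i != i1 -> upd (tup x y w) i (Aux i c) = tup x y (upd w i c).
Proof.
move=> /negPf n0 /negPf n1; apply/funext => j; rewrite /upd /tup.
by case: eqP => [->|]; rewrite ?n0 ?n1.
Qed.

Definition value (α N : nat) (y : point α N) : nat :=
  match y with Pt k => k | Lbl _ => 0 | Aux _ w => w end.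

Definition sum_colour (n N Q : nat) (r : nat -> 'I_N)
    (u : 'I_n.+3 -> point n.+3 N) : 'I_N :=
  r ((\sum_i value (u i)) %% Q).

Lemma sum_colour_swap01 (n N Q : nat) (r : nat -> 'I_N)
    (u : 'I_n.+3 -> point n.+3 N) :
  sum_colour Q r (swap01 u) = sum_colour Q r u.
Proof.
rewrite /sum_colour /swap01; congr (r (_ %% Q)).
by rewrite [RHS](reindex_inj (@perm_inj _ (tperm i0 i1))).
Qed.

(** Among the 2Q + 1 vertices, those other than a given one represent all
    residues modulo Q. *)
Lemma sum_colour_line (n Q : nat) (Ty : Type) (ty : 'I_Q.*2 -> Ty)
    (r : nat -> 'I_Q.*2) :
  (forall c, exists2 k, k < Q & ty (r k) = ty c) ->
  every_line_coloured ty (@sum_colour n Q.*2 Q r).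
Proof.
move=> rP u i c [x [y [w [xy ->]]]]; have [k kQ <-] := rP c.
pose s := \sum_(j < n.+3 | j != i) value (tup x y w j).
have colourE z : sum_colour Q r (upd (tup x y w) i z) = r ((value z + s) %% Q).
  rewrite /sum_colour (bigD1 i) //= {1}/upd eqxx; congr (r ((_ + _) %% Q)).
  by apply: eq_bigr => j /negPf ji; rewrite /upd ji.
have [i_0|n0] := eqVneq i i0.
  have [z [zQ zy zk]] := residue_avoiding s y kQ.
  exists (Pt (Ordinal (leqW zQ))); last by rewrite colourE /= zk.
  by rewrite i_0 upd_tup0; exists (Ordinal (leqW zQ)), y, w.
have [i_1|n1] := eqVneq i i1.
  have [z [zQ zx zk]] := residue_avoiding s x kQ.
  exists (Pt (Ordinal (leqW zQ))); last by rewrite colourE /= zk.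
  by rewrite i_1 upd_tup1; exists x, (Ordinal (leqW zQ)), w; rewrite eq_sym.
have [z zQ zk] := residue s kQ.
have zN : z < Q.*2 by rewrite -addnn ltn_addr.
exists (Aux i (Ordinal zN)); last by rewrite colourE /= zk.
by rewrite upd_tup_aux //; exists x, y, (upd w i (Ordinal zN)).
Qed.

Definition slope (n N : nat) (u : 'I_n.+3 -> point n.+3 N) : nat :=
  match u i0, u i1 with Pt x, Pt y => (val (y - x)%R).-1 | _, _ => 0 end.

(** The difference of two distinct vertices modulo N + 1 is one of N nonzero
    residues, hence the predecessor in [slope]; the other coordinates shift the
    colour modulo N. *)
Definition latin_colour (n N : nat) (N_gt0 : 0 < N)
    (u : 'I_n.+3 -> point n.+3 N) : 'I_N :=
  Ordinal (ltn_pmod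
    (slope u + \sum_(i < n.+3 | (i != i0) && (i != i1)) value (u i)) N_gt0).

Lemma latin_colour_line (n N : nat) (N_gt0 : 0 < N) :
  every_line_coloured id (@latin_colour n N N_gt0).
Proof.
move=> u i c [x [y [w [xy ->]]]].
pose s := \sum_(j < n.+3 | (j != i0) && (j != i1)) value (tup x y w j).
have [d dN ds] := residue s (ltn_ord c).
pose δ : 'I_N.+1 := inord d.+1.
have δE : (val δ).-1 = d by rewrite /= inordK.
have δ0 : δ != 0%R by rewrite -val_eqE /= inordK.
have sumE x' y' : \sum_(j < n.+3 | (j != i0) && (j != i1)) value (tup x' y' w j) = s.
  by apply: eq_bigr => j /andP[/negPf n0 /negPf n1]; rewrite /tup n0 n1.
have colourE x' y' : val (latin_colour N_gt0 (tup x' y' w)) =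
    ((val (y' - x')%R).-1 + s) %% N by rewrite -(sumE x' y').
have [i_0|n0] := eqVneq i i0.
  exists (Pt (y - δ)%R); rewrite i_0 upd_tup0.
    exists (y - δ)%R, y, w; split=> //.
    by rewrite -GRing.subr_eq0 GRing.addrAC GRing.subrr GRing.sub0r GRing.oppr_eq0.
  by apply: val_inj; rewrite colourE GRing.subKr δE ds.
have [i_1|n1] := eqVneq i i1.
  exists (Pt (x + δ)%R); rewrite i_1 upd_tup1.
    exists x, (x + δ)%R, w; split=> //.
    by rewrite eq_sym -GRing.subr_eq0 GRing.addrAC GRing.subrr GRing.add0r.
  by apply: val_inj; rewrite colourE GRing.addrAC GRing.subrr GRing.add0r δE ds.
pose s' := slope (tup x y w) +
  \sum_(j < n.+3 | ((j != i0) && (j != i1)) && (j != i)) value (tup x y w j).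
have [z zN zs] := residue s' (ltn_ord c).
exists (Aux i (Ordinal zN)); rewrite upd_tup_aux //.
  by exists x, y, (upd w i (Ordinal zN)).
apply: val_inj; rewrite /= (bigD1 i) ?n0 //= -[RHS]zs addnCA; congr ((_ + (_ + _)) %% N).
  by rewrite /tup (negPf n0) (negPf n1) /upd eqxx.
apply: eq_bigr => j /andP[/andP[/negPf m0 /negPf m1] /negPf ji].
by rewrite /tup m0 m1 /upd ji.
Qed.

(** * Equations in coloured algebras *)

Definition colour_class (n N : nat) (j : nat) : set (coloured_tuple n N) :=
  [set z : coloured_tuple n N | edges z.1 /\ z.2 = j :> nat].

Definition label (n N : nat) (k : nat) : set (coloured_tuple n N) :=
  [set z : coloured_tuple n N |
    exists p (l : 'I_N.+1), [/\ l = k :> nat, z.1 i0 = Lbl p & z.1 i1 = Pt (p l)]].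

Lemma admissible_colour_class (n N j : nat) : admissible (@colour_class n N j).
Proof.
split=> [σ τ u c [[x [y [w [xy /= ->]]]] cj]|u c c' nu [//]].
split=> //; exists (σ x), (σ y), (fun i => τ i (w i)).
split; first by rewrite /= (inj_eq perm_inj).
by apply/funext => i; rewrite /tup /=; case: eqP => // _; case: eqP.
Qed.

Lemma admissible_label (n N k : nat) : admissible (@label n N k).
Proof.
split=> // σ τ u c [p [l [lk /= u0 u1]]]; exists (p * σ)%g, l.
by rewrite /= u0 u1 /= permM.
Qed.

Lemma coloured_factorization (n N : nat) :
  factorization N (@ccyl n N) (@cdiag n N) (@cP01 n N)
    (@colour_class n N) (@label n N).
Proof.
split.
- move=> i iN j jN [u c] [eu ci]; apply/cylinderE; exists (u i0).
  by rewrite updK; exists (Ordinal jN).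
- by move=> i iN j jN ij [u c] [_ /= ci] [_ /= cj]; apply: ij; rewrite -ci.
- move=> j jN [u c] /P01E [/edges_swap01 eu cj]; split=> //.
  by rewrite swap01K in eu.
- move=> j jN [u c] [[x [y [w [xy /= ->]]]] _] [xyE].
  by move: xy; rewrite xyE eqxx.
- move=> [u c] _; apply/cylinderE; exists (Lbl 1%g), c; apply/cylinderE.
  by exists (Pt ord0), c, 1%g, ord0; rewrite /upd /= perm1.
- move=> [u c] [/cylinderE[t [c1 [p [l [_ u0 _]]]]]].
  move=> /cylinderE[z [c2 [[x [y [w [xy uE]]]] _]]].
  have u1 : u i1 = Pt y by move: (congr1 (fun f => f i1) uE).
  exists ((p^-1)%g y) => //=; exists p, ((p^-1)%g y); split=> //=.
  by rewrite permKV.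
- move=> k kN [u c] /cylinderE[t [c1 [p [l [lk u0 u1]]]]].
  by exists p, l.
- move=> k kN [u c] [[p [l [lk /= u0 u1]]]].
  move=> /cylinderE[t [c1 [d12 [p' [l' [l'k u0' u1']]]]]].
  rewrite /cdiag /diagonal /= /upd /= in d12 u0' u1' *.
  have pp : p = p' by move: u0'; rewrite u0 => -[].
  have ll : l = l' by apply: val_inj; rewrite /= lk l'k.
  by rewrite u1 -d12 u1' pp ll.
Qed.

Lemma edges_inhabited (n N : nat) : 0 < N -> @edges n N !=set0.
Proof.
move=> N_gt0; exists (tup ord0 ord_max (fun=> Ordinal N_gt0)).
by exists ord0, ord_max, (fun=> Ordinal N_gt0); rewrite -val_eqE /= eq_sym -lt0n.
Qed.

(** The colour classes of edges satisfy the conditions of [factorization]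
    without being empty. *)
Lemma coloured_algebra_not_valid (n N : nat) : 0 < N ->
  ~ forall v : nat -> carrier (coloured_algebra n N),
      eval v (factorization_equation n N).1 = eval v (factorization_equation n N).2.
Proof.
move=> N_gt0 valid.
pose v k : carrier (coloured_algebra n N) :=
  if odd k then exist _ _ (@admissible_label n N k./2)
  else exist _ _ (@admissible_colour_class n N k./2).
have /(congr1 sval) := valid v; rewrite !sval_eval_coloured.
move=> /factorization_equation_fails v0.
have [u eu] := @edges_inhabited n N N_gt0.
suff : @colour_class n N 0 (u, Ordinal N_gt0).
  have -> : colour_class 0 = sval (v 0) :> set (coloured_tuple n N) by [].
  rewrite v0 // => [i|]; first by rewrite -subset0 => z /cylinderE[y []].
  have -> : (fun j => sval (v j.*2)) = @colour_class n N.
    by apply/funext => j; rewrite /v odd_double doubleK.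
  have -> : (fun k => sval (v k.*2.+1)) = @label n N.
    by apply/funext => j; rewrite /v /= odd_double /= uphalf_double.
  exact: coloured_factorization.
by split.
Qed.

(** The type of a colour records which of the first m variables contain it at the
    edge u0. There are 2^m types, half as many as colours, which leaves room for
    a symmetric colouring. *)
Lemma few_variables_valid (n m : nat) (e : equation n.+3)
    (v : nat -> carrier (coloured_algebra n (2 ^ m).*2)) :
  true_in (@set_algebras n.+3) e ->
  maxn (var_bound e.1) (var_bound e.2) <= m -> eval v e.1 = eval v e.2.
Proof.
move=> te em; set Q := 2 ^ m in v *.
have N_gt0 : 0 < Q.*2 by rewrite double_gt0 expn_gt0.
have [u0 eu0] := @edges_inhabited n _ N_gt0.
pose ty c := [ffun k : 'I_m => `[< sval (v k) (u0, c) >]].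
have cardTy : #|{ffun 'I_m -> bool}| = Q by rewrite card_ffun card_bool card_ord.
have /choice[r rP] (k : nat) : exists c, forall c', enum_rank (ty c') = k :> nat ->
    ty c = ty c'.
  have [[c' c'k]|no] := pselect (exists c', enum_rank (ty c') = k :> nat).
    exists c' => c'' c''k; apply: (can_inj (@enum_rankK _)).
    by apply: val_inj; rewrite /= c'k c''k.
  by exists (Ordinal N_gt0) => c' c'k; case: no; exists c'.
apply: (@coloured_equation n _ _ ty (sum_colour Q r)) => //.
- apply: sum_colour_line => c; exists (enum_rank (ty c)); last exact: rP.
  by rewrite -cardTy ltn_ord.
- move=> k ke u c c' tcc' Zu; have km := leq_trans ke em.
  have aZ := svalP (v k); have [eu|neu] := pselect (edges u); last first.
    exact: (admissible_colour aZ _ neu Zu).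
  apply: (admissible_edges aZ eu0 eu).
  have /ffunP/(_ (Ordinal km)) := tcc'; rewrite !ffunE /=.
  move=> tyE; apply/asboolP; rewrite -tyE; apply/asboolP.
  exact: (admissible_edges aZ eu eu0 Zu).
- by move=> _ u; apply: sum_colour_swap01.
Qed.

(** Any number of variables may tell all N colours apart; the colouring by
    differences still has every colour on every line. *)
Lemma p01_free_valid (n N : nat) (e : equation n.+3)
    (v : nat -> carrier (coloured_algebra n N)) : 0 < N ->
  true_in (@set_algebras n.+3) e -> eq_occ_p01 e = 0 -> eval v e.1 = eval v e.2.
Proof.
move=> N_gt0 te e0; apply: (coloured_equation te (latin_colour_line N_gt0)).
  by move=> k _ u c c' <-.
by rewrite e0.
Qed.

Theorem mainTheorem4 (α : nat) (hα : 3 <= α) :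
  ~ exists E : set (equation α),
      equational_axiom_set (@set_algebras α) E /\ p01_occurs_finitely E.
Proof.
case: α hα => [|[|[|n]]] // _ [E [[Etrue Ecomplete] /p01_variables_bounded[m Em]]].
set N := (2 ^ m).*2.
have N_gt0 : 0 < N by rewrite double_gt0 expn_gt0.
apply: (@coloured_algebra_not_valid n N N_gt0) => v.
apply: derivable_sound (Ecomplete _ _) v; last first.
  by apply: factorization_equation_valid => //; rewrite odd_double.
move=> s t Est v; have est := Etrue _ Est.
have [e0|] := posnP (eq_occ_p01 (s, t)); first exact: p01_free_valid est e0.
by move=> /(Em _ Est); apply: few_variables_valid est.
Qed.
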